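(* The metric group $\mathbb{G}$, defined as the metric completion of the Fraïssé limit $(G,d)$ of the class $\mathcal{G}$, is isometric (as a metric space) to the Urysohn universal space.
   Context: Finitely generated metrics. A metric $d$ on an abelian group $G$ is finitely generated if there is a finite set $A\subseteq G^2$ (a generating set for the metric) such that for all $a,b\in G$, $d(a,b)=\min\{d(a_1,b_1)+\ldots+d(a_n,b_n): n\in\mathbb{N},\ (a_i,b_i)\in A \text{ for } i\le n,\ a=a_1+\ldots+a_n,\ b=b_1+\ldots+b_n\}$; in particular every pair $(a,b)\in G^2$ admits at least one such decomposition. Such a metric is automatically invariant. It is rational if it takes values in $\mathbb{Q}$. The class $\mathcal{G}$. Elements of $\mathcal{G}$ are the groups $\mathbb{Z}^n$ (finite direct sums of $\mathbb{Z}$, with their distinguished free generators) equipped with finitely generated rational metrics. The set $\mathcal{M}$ of morphisms consists of the isometric group monomorphisms $f:K\to H$ ($K,H\in\mathcal{G}$) that send the distinguished free generators of $K$ to distinguished free generators of $H$ (so the image of $K$ is a direct summand of $H$). Write $K\sqsubseteq H$ if there is a morphism in $\mathcal{M}$ from $K$ to $H$; for a subgroup, this means the inclusion is in $\mathcal{M}$. The limit. $(G,d)$ denotes the Fraïssé limit of $(\mathcal{G},\mathcal{M})$, i.e. the unique, up to isometric isomorphism, countable abelian group with invariant metric such that: (1) $G$ is a direct limit (increasing union) of a sequence $K_1\sqsubseteq K_2\sqsubseteq\ldots$ of members of $\mathcal{G}$ with connecting maps in $\mathcal{M}$; (2) every $A\in\mathcal{G}$ admits a morphism in $\mathcal{M}$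 into some $K_m$; (3) for any $A_1,A_2\in\mathcal{G}$ and $\iota_1:A_1\to K_n$, $\rho:A_1\to A_2$ in $\mathcal{M}$ there are $m>n$ and $\iota_2:A_2\to K_m$ in $\mathcal{M}$ with $\iota_2\circ\rho=\iota_1$. Algebraically $G$ is the free abelian group on countably many generators. $\mathbb{G}$ is the metric completion of $(G,d)$, with the extended group operations and metric. The Urysohn universal space is the unique (up to isometry) complete separable metric space $U$ that contains an isometric copy of every separable metric space and in which every isometry between finite subsets extends to an isometry of $U$ onto itself. *)

(* Defs.v *)
From HB Require Import structures.
From mathcomp Require Import all_boot all_order all_algebra.
From mathcomp Require Import all_classical all_reals topology.

Set Implicit Arguments.
Unset Strict Implicit.
Unset Printing Implicit Defensive.

Import Order.TTheory GRing.Theory Num.Theory.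

Local Open Scope classical_set_scope.
Local Open Scope ring_scope.

(* Only [topology] is imported above: this structure cannot be declared once
   the normed part of mathcomp-analysis is loaded (missing join); loading it
   afterwards is fine.
   Abelian groups carrying a metric; no compatibility between the two
   structures is built in, see [invariant_metric]. *)
#[short(type="metricZmodType")]
HB.structure Definition MetricZmodule (R : numDomainType) :=
  {G of Metric R G & GRing.Zmodule G}.

Section MetricSpaces.
Variable R : realType.

Definition isometric_map (X Y : metricType R) (f : X -> Y) : Prop :=
  forall x y : X, mdist (f x) (f y) = mdist x y.

(* isometric bijections; injectivity follows from [isometric_map] *)
Definition isometric (X Y : metricType R) : Prop :=
  exists f : X -> Y, isometric_map f /\ (forall y : Y, exists x : X, f x = y).

(* the axiom of the library's [completeType], for possibly non-pointed types *)
Definition complete_metric (X : metricType R) : Prop :=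
  forall F : set_system X, ProperFilter F -> cauchy F -> exists l : X, F --> l.

Definition separable_metric (X : metricType R) : Prop :=
  exists2 D : set X, countable D & dense D.

Definition urysohn_space (U : metricType R) : Prop :=
  [/\ complete_metric U,
      separable_metric U,
      (forall M : metricType R, separable_metric M ->
          exists f : M -> U, isometric_map f) &
      (forall (A B : set U) (f : U -> U),
          finite_set A -> finite_set B -> set_bij A B f ->
          (forall x y, A x -> A y -> mdist (f x) (f y) = mdist x y) ->
          exists g : U -> U,
            [/\ isometric_map g, (forall y, exists x, g x = y) &
                forall x, A x -> g x = f x])].

Definition invariant_metric (G : metricZmodType R) : Prop :=
  forall a b c : G, mdist (a + c) (b + c) = mdist a b.

(* The metric group completion of [G]: the group operations of [X] are those
   extending the ones of [G], since an invariant metric makes them continuous. *)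
Definition metric_group_completion (G X : metricZmodType R)
    (i : {additive G -> X}) : Prop :=
  [/\ complete_metric X, invariant_metric X, isometric_map i & dense (range i)].

End MetricSpaces.

Section FinitelyGenerated.
Variables (R : realType) (G : zmodType) (d : G -> G -> R).

Definition is_metric : Prop :=
  [/\ forall x, d x x = 0,
      forall x y, d x y = 0 -> x = y,
      forall x y, d x y = d y x &
      forall y x z, d x z <= d x y + d y z].

(* A decomposition of (a, b) over A is the list of the pairs (a_i, b_i). The
   empty list only decomposes (0, 0), with cost 0 = d 0 0; allowing it is
   immaterial, as (0, 0) can always be put in a generating set. *)
Definition decomposition_costs (A : set (G * G)) (a b : G) : set R :=
  [set r | exists s : seq (G * G),
     [/\ forall p, p \in s -> A p,
         a = \sum_(p <- s) p.1, b = \sum_(p <- s) p.2 &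
         r = \sum_(p <- s) d p.1 p.2]].

Definition finitely_generated_metric : Prop :=
  exists2 A : set (G * G), finite_set A &
    forall a b : G, decomposition_costs A a b (d a b) /\
                    lbound (decomposition_costs A a b) (d a b).

Definition rational_metric : Prop :=
  forall a b : G, exists q : rat, d a b = ratr q.

End FinitelyGenerated.

Record calG (R : realType) := CalG {
  calG_rank : nat ;
  calG_dist : 'rV[int]_calG_rank -> 'rV[int]_calG_rank -> R ;
  calG_metric : is_metric calG_dist ;
  calG_fg : finitely_generated_metric calG_dist ;
  calG_rational : rational_metric calG_dist
}.

Definition calG_sort (R : realType) (K : calG R) : Type :=
  'rV[int]_(calG_rank K).
Coercion calG_sort : calG >-> Sortclass.

HB.instance Definition _ (R : realType) (K : calG R) :=
  GRing.Zmodule.on (calG_sort K).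

Section CalGMetric.
Variables (R : realType) (K : calG R).

Lemma calG_distxx (x : K) : calG_dist x x = 0.
Proof. by case: (calG_metric K). Qed.

Lemma calG_dist_eq0 (x y : K) : calG_dist x y = 0 -> x = y.
Proof. by case: (calG_metric K) => _ + _ _; exact. Qed.

Lemma calG_dist_sym (x y : K) : calG_dist x y = calG_dist y x.
Proof. by case: (calG_metric K). Qed.

Lemma calG_dist_triangle (y x z : K) :
  calG_dist x z <= calG_dist x y + calG_dist y z.
Proof. by case: (calG_metric K). Qed.

HB.instance Definition _ := isMetric.Build R (calG_sort K)
  calG_distxx calG_dist_eq0 calG_dist_sym calG_dist_triangle.

End CalGMetric.

Definition calG_gen (R : realType) (K : calG R) (i : 'I_(calG_rank K)) : K :=
  delta_mx 0 i.

Definition calM (R : realType) (K H : calG R) (f : {additive K -> H}) : Prop :=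
  [/\ injective f, isometric_map f &
      forall i, exists j, f (calG_gen i) = calG_gen j].

(* The direct limit is presented by its canonical maps [g n : K n -> G]. *)
Definition fraisse_limit (R : realType) (G : metricZmodType R) : Prop :=
  [/\ countable [set: G],
      invariant_metric G &
      exists (K : nat -> calG R) (c : forall n, {additive K n -> K n.+1})
             (g : forall n, {additive K n -> G}),
        [/\ [/\ forall n, calM (c n),
                forall n, isometric_map (g n),
                forall n (x : K n), g n.+1 (c n x) = g n x &
                forall x : G, exists n (y : K n), g n y = x],
            (forall A : calG R, exists m (f : {additive A -> K m}), calM f) &
            (forall (A1 A2 : calG R) n (i1 : {additive A1 -> K n})
                    (rho : {additive A1 -> A2}), calM i1 -> calM rho ->
               exists m (i2 : {additive A2 -> K m}),
                 [/\ (n < m)%N, calM i2 &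
                     forall x : A1, g m (i2 (rho x)) = g n (i1 x)])]].

(* Main.v *)
Require Import Defs.
From HB Require Import structures.
From mathcomp Require Import all_boot all_order all_algebra.
From mathcomp Require Import all_classical all_reals topology.
From mathcomp Require Import lra zify.

(* A complete separable metric space is Urysohn as soon as every Katetov
   function on a finite subset is realized as the distance to some point: this
   gives universality, homogeneity and uniqueness by back-and-forth, and by
   completeness it is enough to realize such functions up to epsilon. For the
   completion of G, finitely many points may therefore be moved into a member K
   of the Fraisse sequence and the prescribed distances f p replaced by rational
   ones. Adjoin a free generator e to K with the largest invariant metric such
   that d(e, p) <= f p for the given points p. As d(p, q) <= f p + f q, a pair
   of opposite relations e - p and -(e - q) can always be cancelled without
   increasing the cost, so that the distance is a minimum over finitely many
   words. Hence the metric is rational and finitely generated, extends that of K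
   and satisfies d(e, p) = min_q (f q + d(q, p)). The amalgamation property
   then provides a copy of e in G. *)

Set Implicit Arguments.
Unset Strict Implicit.
Unset Printing Implicit Defensive.

Import Order.TTheory GRing.Theory Num.Theory.

Local Open Scope classical_set_scope.
Local Open Scope ring_scope.

(** * Katetov functions *)

Section MetricToolkit.
Variable R : realType.

Lemma dense_mdistP (X : metricType R) (D : set X) :
  dense D <-> forall x e, 0 < e -> exists2 y, D y & mdist x y < e.
Proof.
split=> [Dd x e e0|Dd O [x Ox] Oo].
  have [y [xy Dy]] := Dd _ (ex_intro _ x (nbhs_singleton
    (nbhs_interior (nbhsx_ballx x e e0)))) (open_interior _).
  exists y => //; have := interior_subset xy.
  by rewrite ballEmdist.
have /nbhs_ballP[e /= e0 sO] : nbhs x O by apply: open_nbhs_nbhs.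
have [y Dy xy] := Dd x e e0; exists y; split => //.
by apply: sO; rewrite ballEmdist.
Qed.

Lemma exists_half_pow_lt (e : R) : 0 < e -> exists n : nat, 2^-1 ^+ n < e.
Proof.
move=> e0; exists (Num.bound e^-1).
rewrite exprVn invf_plt ?posrE ?exprn_gt0//.
apply: lt_trans (archi_boundP _) _; first by rewrite invr_ge0 ltW.
by rewrite -natrX ltr_nat ltn_expl.
Qed.

Lemma complete_seq (X : metricType R) (s : nat -> X) :
  complete_metric X -> (forall n, mdist (s n) (s n.+1) <= 2^-1 ^+ n) ->
  exists l, forall n, mdist (s n) l <= 2 * 2^-1 ^+ n.
Proof.
move=> cX sd.
(* The subtracted term strengthens the geometric bound so that the induction on [k] closes. *)
have sD n k : mdist (s n) (s (n + k)%N) <= 2 * (2^-1 ^+ n - 2^-1 ^+ (n + k)).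
  elim: k => [|k IH]; first by rewrite addn0 mdistxx subrr mulr0.
  have := metric_triangle (s n) (s (n + k)%N) (s (n + k.+1)%N).
  have := sd (n + k)%N; rewrite addnS exprS.
  lra.
have p2 k : 0 < 2^-1 ^+ k :> R by rewrite exprn_gt0// invr_gt0.
have sD2 n m : (n <= m)%N -> mdist (s n) (s m) < 2 * 2^-1 ^+ n.
  move=> nm; rewrite -(subnKC nm).
  have := sD n (m - n)%N; have := p2 (n + (m - n))%N; lra.
have [|l sl] := cX (s @ \oo) _.
  apply/cauchy_ballP => e e0.
  have [N Ne] : exists n : nat, 2^-1 ^+ n < e / 4.
    by apply: exists_half_pow_lt; rewrite divr_gt0.
  exists ([set s n | n in [set n | (N <= n)%N]],
          [set s n | n in [set n | (N <= n)%N]]).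
    by split; exists N => // n /= Nn; exists n.
  move=> [_ _] [/= [n Nn <-] [m Nm <-]]; rewrite ballEmdist /=.
  have := metric_triangle (s n) (s N) (s m).
  by have := sD2 _ _ Nn; have := sD2 _ _ Nm; rewrite (metric_sym (s n) (s N));
    lra.
exists l => n; apply/ler_addgt0Pl => e e0.
have /sl[N _ Ns] := nbhsx_ballx l e e0.
have := Ns (maxn n N) (leq_maxr _ _); rewrite /= ballEmdist/= => le.
have := metric_triangle (s n) (s (maxn n N)) l.
have := sD2 _ _ (leq_maxl n N).
rewrite metric_sym in le; lra.
Qed.

(* A function on a finite set is given by its graph [T]; the condition makes a
   repeated point carry a single value. *)
Definition katetov (X : metricType R) (T : seq (X * R)) :=
  forall t u, t \in T -> u \in T ->
    t.2 <= mdist t.1 u.1 + u.2 /\ mdist t.1 u.1 <= t.2 + u.2.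

Definition extension_property (X : metricType R) :=
  forall T : seq (X * R), katetov T ->
    exists x, forall t, t \in T -> mdist x t.1 = t.2.

Definition approximate_extension_property (X : metricType R) :=
  forall (T : seq (X * R)) e, 0 < e -> katetov T ->
    exists x, forall t, t \in T -> `|mdist x t.1 - t.2| <= e.

Lemma katetov_ge0 (X : metricType R) (T : seq (X * R)) t :
  katetov T -> t \in T -> 0 <= t.2.
Proof. by move=> kT tT; have [_] := kT t t tT tT; rewrite mdistxx; lra. Qed.

(** Folding [Num.max] from 0 covers the empty list; the last clause records that [e] is least among
    nonnegative bounds. *)
Lemma seq_max (I : eqType) (s : seq I) (g : I -> R) :
  exists2 e, 0 <= e & (forall t, t \in s -> g t <= e) /\
    (forall b, 0 <= b -> (forall t, t \in s -> g t <= b) -> e <= b).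
Proof.
elim: s => [|u s [e e0 [es ub]]]; first by exists 0.
exists (Num.max (g u) e); first by rewrite le_max e0 orbT.
split=> [t|b b0 sb].
  by rewrite inE le_max => /orP[/eqP->|/es->]; rewrite ?lexx ?orbT.
rewrite ge_max sb ?mem_head//= ub// => t ts.
by apply: sb; rewrite inE ts orbT.
Qed.

(** The value [e] is the sup distance over [T] between the given function and the distance to [x],
    the least value that [x] can receive. An approximate solution [x] thus gets a small value, which
    keeps the next approximation near it. *)
Lemma katetov_cons (X : metricType R) (T : seq (X * R)) x :
  katetov T -> exists2 e, katetov ((x, e) :: T) &
    forall b, 0 <= b -> (forall t, t \in T -> `|mdist x t.1 - t.2| <= b) ->
      e <= b.
Proof.
move=> kT; have [e e0 [eT ub]] := seq_max T (fun t => `|mdist x t.1 - t.2|).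
exists e => //.
have kx t : t \in T -> [/\ t.2 <= mdist x t.1 + e,
    e <= mdist x t.1 + t.2 & mdist x t.1 <= t.2 + e].
  move=> tT; have /ler_normlP[] := eT t tT => ? ?.
  split; [lra| |lra].
  (* By leastness of [e] it suffices to bound every difference at [u] by [mdist x t.1 + t.2]. *)
  apply: ub => [|u uT]; first by rewrite addr_ge0 ?mdist_ge0 ?(katetov_ge0 kT).
  have [ut1 _] := kT u t uT tT; have [tu1 tu2] := kT t u tT uT.
  have := metric_triangle x t.1 u.1; have := metric_triangle t.1 x u.1.
  have := metric_triangle u.1 x t.1.
  rewrite (metric_sym u.1 x) (metric_sym t.1 x) (metric_sym u.1 t.1).
  rewrite (metric_sym u.1 t.1) in ut1.
  by move=> ? ? ?; apply/ler_normlP; split; lra.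
move=> t u; rewrite !inE => /orP[/eqP->|tT] /orP[/eqP->|uT] /=.
- by rewrite mdistxx; lra.
- by have [] := kx u uT; lra.
- by rewrite (metric_sym t.1 x); have [] := kx t tT; lra.
- exact: kT.
Qed.

(** A solution [x] up to 2^-(n+2) is added to [T] with a value at most 2^-(n+2). Solving the
    enlarged problem up to 2^-(n+3) improves the error and moves [x] by less than 2^-n, so the
    approximations converge. *)
Lemma complete_extension (X : metricType R) :
  complete_metric X -> approximate_extension_property X -> extension_property X.
Proof.
move=> cX aX T kT.
pose good n x := forall t, t \in T -> `|mdist x t.1 - t.2| <= 2^-1 ^+ n.+2.
have p2 k : 0 < 2^-1 ^+ k :> R by rewrite exprn_gt0// invr_gt0.
have step (q : nat * {x : nat * X | good x.1 x.2}) :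
    exists q' : {x : nat * X | good x.1 x.2}, (sval q').1 = (sval q.2).1.+1 /\
      mdist (sval q.2).2 (sval q').2 <= 2^-1 ^+ (sval q.2).1.
  case: q => _ [[n x] /= gx].
  have [e kxT ub] := katetov_cons x kT.
  have [y yT] := aX _ _ (p2 n.+3) kxT.
  have gy : good n.+1 y by move=> t tT; apply: yT; rewrite inE tT orbT.
  exists (exist _ (n.+1, y) gy); split => //=.
  have := yT (x, e); rewrite inE eqxx /= => /(_ isT)/ler_normlP[_].
  have := ub _ (ltW (p2 n.+2)) gx; rewrite !exprS (metric_sym y x).
  have := p2 n; lra.
have [f fP] := choice step.
have [x0 gx0] := aX _ _ (p2 2) kT.
pose s := fix s n := if n is n'.+1 then f (0%N, s n')
  else exist (fun x : nat * X => good x.1 x.2) (0%N, x0) gx0.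
have s1 n : (sval (s n)).1 = n.
  by elim: n => //= n IH; have [-> _] := fP (0%N, s n); rewrite /= IH.
have [l lP] : exists l, forall n, mdist (sval (s n)).2 l <= 2 * 2^-1 ^+ n.
  apply: complete_seq => // n.
  by have [_] := fP (0%N, s n); rewrite /= s1.
exists l => t tT.
(* The factor 3 absorbs 2 * 2^-n from the distance to the limit and 2^-(n+2) from the error of
   [s n]. *)
have lt n : `|mdist l t.1 - t.2| <= 3 * 2^-1 ^+ n.
  have := svalP (s n) t tT => /ler_normlP[]; rewrite s1 !exprS => a b.
  have c := lP n.
  have := metric_triangle l (sval (s n)).2 t.1.
  have := metric_triangle (sval (s n)).2 l t.1.
  rewrite (metric_sym l (sval _).2) => d e.
  have := p2 n => p.
  by apply/ler_normlP; split; lra.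
apply/eqP; rewrite -subr_eq0 -normr_le0; apply/ler_addgt0Pl => e e0.
have [n] : exists n : nat, 2^-1 ^+ n < e / 3.
  by apply: exists_half_pow_lt; rewrite divr_gt0.
have := lt n; lra.
Qed.

End MetricToolkit.

(** * Partial isometries and back-and-forth *)

Section PartialIsometries.
Variable R : realType.

(** A partial isometry is encoded by its graph; pairs at distance 0 coincide, so the relation is
    automatically functional and injective. *)
Definition partial_isometry (X Y : metricType R) (I : set (X * Y)) :=
  forall p q, I p -> I q -> mdist p.1 q.1 = mdist p.2 q.2.

Definition flip (X Y : Type) (I : set (X * Y)) : set (Y * X) :=
  [set p | I (p.2, p.1)].

Lemma partial_isometry_flip (X Y : metricType R) (I : set (X * Y)) :
  partial_isometry I -> partial_isometry (flip I).
Proof. by move=> iI p q Ip Iq; rewrite (iI _ _ Ip Iq). Qed.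

(** Domain points converging to [x] have Cauchy images, whose limit is [y]. The distances to all of
    [I] determine [y] when the range is dense, which later yields surjectivity. *)
Lemma partial_isometry_limit (X Y : metricType R) (I : set (X * Y)) (x : X) :
  complete_metric Y -> partial_isometry I -> dense (fst @` I) ->
  exists y, forall p, I p -> mdist p.2 y = mdist p.1 x.
Proof.
move=> cY iI /dense_mdistP dI.
have p2 k : 0 < 2^-1 ^+ k :> R by rewrite exprn_gt0// invr_gt0.
have /choice[s sP] : forall n, exists p, I p /\ mdist x p.1 < 2^-1 ^+ n.+1.
  by move=> n; have [_ [p Ip <-] xp] := dI x _ (p2 n.+1); exists p.
have [y yP] : exists y, forall n, mdist (s n).2 y <= 2 * 2^-1 ^+ n.
  apply: complete_seq => // n.
  have [In dn] := sP n; have [In1 dn1] := sP n.+1.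
  rewrite -(iI _ _ In In1); move: dn1.
  have := metric_triangle (s n).1 x (s n.+1).1.
  by rewrite (metric_sym _ x); move: dn (p2 n); rewrite !exprS; lra.
exists y => p Ip; apply/eqP; rewrite -subr_eq0 -normr_le0.
apply/ler_addgt0Pl => e e0.
have [n ne] : exists n : nat, 2^-1 ^+ n < e / 3.
  by apply: exists_half_pow_lt; rewrite divr_gt0.
have [In] := sP n; have := yP n; have := iI _ _ Ip In; rewrite exprS.
have := metric_triangle p.1 (s n).1 x; have := metric_triangle p.1 x (s n).1.
have := metric_triangle p.2 (s n).2 y; have := metric_triangle p.2 y (s n).2.
rewrite (metric_sym p.1 x) (metric_sym (s n).1 x) (metric_sym y).
by move=> *; apply/ler_normlP; have := p2 n; split; lra.
Qed.

(** Surjectivity is conditional so that universality, where only the domain is dense, is covered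
    too. *)
Lemma partial_isometry_extend (X Y : metricType R) (I : set (X * Y)) :
  complete_metric Y -> partial_isometry I -> dense (fst @` I) ->
  exists f : X -> Y, [/\ isometric_map f, forall p, I p -> f p.1 = p.2 &
    complete_metric X -> dense (snd @` I) -> forall y, exists x, f x = y].
Proof.
move=> cY iI dI.
have [f fP] := choice (fun x => partial_isometry_limit x cY iI dI).
exists f; split.
- move=> x x'; apply/eqP; rewrite -subr_eq0 -normr_le0.
  apply/ler_addgt0Pl => e e0.
  have [|_ [p Ip <-] xp] := (dense_mdistP _).1 dI x (e / 2).
    by rewrite divr_gt0.
  have := fP x p Ip; have := fP x' p Ip.
  have := metric_triangle p.1 x x'; have := metric_triangle x p.1 x'.
  have := metric_triangle p.2 (f x) (f x');
    have := metric_triangle (f x) p.2 (f x').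
  rewrite (metric_sym (f x) p.2) (metric_sym x p.1) in xp *.
  by move=> *; apply/ler_normlP; split; lra.
- by move=> p Ip; apply/esym/mdist_positivity; rewrite fP// mdistxx.
- move=> cX dI2 y.
  have dI2' : dense (fst @` flip I).
    move=> O O0 Oo; have [z [Oz [p Ip pz]]] := dI2 O O0 Oo.
    by exists z; split => //; exists (p.2, p.1) => //; case: (p) Ip.
  (* The limit of the inverse relation at [y] is the candidate preimage: [f x] and [y] have equal
     distances to the dense range of [I]. *)
  have [x xP] := partial_isometry_limit y cX (partial_isometry_flip iI) dI2'.
  exists x; apply: mdist_positivity; apply/eqP;
    rewrite -normr_le0 ger0_norm ?mdist_ge0//.
  apply/ler_addgt0Pl => e e0.
  have [|_ [p Ip <-] yp] := (dense_mdistP _).1 dI2 y (e / 2).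
    by rewrite divr_gt0.
  have := fP x p Ip; have := xP (p.2, p.1);
    rewrite /flip /= -surjective_pairing.
  move=> /(_ Ip); have := metric_triangle (f x) p.2 y.
  rewrite (metric_sym (f x) p.2) (metric_sym p.2 y); lra.
Qed.

(** The distances from [x] to the domain points, carried over to their images, form a Katetov
    function. *)
Lemma partial_isometry_forth (X Y : metricType R) (L : seq (X * Y)) (x : X) :
  extension_property Y -> partial_isometry [set` L] ->
  exists y, partial_isometry [set` (x, y) :: L].
Proof.
move=> eY iL.
have [|y yP] := eY [seq (p.2, mdist x p.1) | p <- L].
  move=> _ _ /mapP[p pL ->] /mapP[q qL ->] /=.
  rewrite -(iL _ _ pL qL); have := metric_triangle p.1 x q.1.
  have := metric_triangle x q.1 p.1.
  by rewrite (metric_sym p.1 x) (metric_sym q.1 p.1); lra.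
have {}yP p : p \in L -> mdist y p.2 = mdist x p.1.
  by move=> pL; rewrite (yP (p.2, mdist x p.1))//; apply/mapP; exists p.
exists y => p q /=; rewrite !inE => /orP[/eqP->|pL] /orP[/eqP->|qL] /=.
- by rewrite !mdistxx.
- by rewrite yP.
- by rewrite metric_sym -yP// metric_sym.
- exact: iL.
Qed.

Lemma partial_isometry_back (X Y : metricType R) (L : seq (X * Y)) (y : Y) :
  extension_property X -> partial_isometry [set` L] ->
  exists x, partial_isometry [set` (x, y) :: L].
Proof.
move=> eX iL.
have [|x xP] := @partial_isometry_forth _ _ [seq (p.2, p.1) | p <- L] y eX.
  by move=> _ _ /= /mapP[p pL ->] /mapP[q qL ->] /=; rewrite (iL _ _ pL qL).
have sw p : p \in (x, y) :: L ->
    (p.2, p.1) \in (y, x) :: [seq (p.2, p.1) | p <- L].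
  rewrite !inE => /orP[/eqP->|pL]; first by rewrite eqxx.
  by apply/orP; right; apply/mapP; exists p.
by exists x => p q pL qL; apply/esym; exact: xP (sw p pL) (sw q qL).
Qed.

(** [Tk n] is the n-th requirement. Requirements persist under enlargement, so meeting them one at a
    time by finite relations and taking the union meets them all. *)
Lemma partial_isometry_chain (X Y : metricType R) (L : seq (X * Y))
    (Tk : nat -> set (set (X * Y))) :
  partial_isometry [set` L] ->
  (forall n I J, Tk n I -> I `<=` J -> Tk n J) ->
  (forall n (M : seq (X * Y)), partial_isometry [set` M] ->
     exists2 N : seq (X * Y),
       partial_isometry [set` N] & [set` M] `<=` [set` N] /\ Tk n [set` N]) ->
  exists I, [/\ partial_isometry I, [set` L] `<=` I & forall n, Tk n I].
Proof.
move=> iL mono step.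
pose S := {L : seq (X * Y) | partial_isometry [set` L]}.
have /choice[f fP] : forall q : nat * S, exists M : S,
    [set` sval q.2] `<=` [set` sval M] /\ Tk q.1 [set` sval M].
  move=> [n [M iM]] /=; have [N iN NP] := step n M iM.
  by exists (exist _ N iN).
pose s := fix s n := if n is n'.+1 then f (n', s n') else exist _ L iL : S.
have sS n k : [set` sval (s n)] `<=` [set` sval (s (n + k)%N)].
  elim: k => [|k IH]; first by rewrite addn0.
  by rewrite addnS; apply: subset_trans IH _;
    have [] := fP ((n + k)%N, s (n + k)%N).
exists (\bigcup_n [set` sval (s n)]); split.
- move=> p q [n _ np] [m _ mq].
  apply: (svalP (s (n + m)%N)); first exact: sS np.
  by rewrite addnC; apply: sS mq.
- by move=> p Lp; exists 0%N.
- move=> n; apply: mono (fP (n, s n)).2 _.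
  by move=> p np; exists n.+1.
Qed.

(** * Universality, homogeneity and uniqueness of the Urysohn space *)

Lemma extension_property_universal (X Y : metricType R) :
  separable_metric X -> complete_metric Y -> extension_property Y ->
  exists f : X -> Y, isometric_map f.
Proof.
move=> [D /countable_injP[c c_inj] dD] cY eY.
(* Requirement [n] asks for an image of the point of [D] with code [n]; it is vacuous if [n] codes
   no point. *)
have [||n L iL|I [iI _ IT]] := @partial_isometry_chain X Y [::]
  (fun n I => forall x, D x -> c x = n -> exists y, I (x, y)) .
- by move=> p q.
- by move=> n I J nI IJ x Dx cx; have [y Iy] := nI x Dx cx; exists y; exact: IJ.
- have [[x Dx cx]|no] := pselect (exists2 x, D x & c x = n); last first.
    by exists L => //; split=> // x Dx cx; case: no; exists x.
  have [y yP] := partial_isometry_forth x eY iL.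
  exists ((x, y) :: L) => //; split=> [p|x' Dx' cx'];
    first by rewrite /= inE => ->; rewrite orbT.
  exists y; rewrite (c_inj x' x) ?inE//; first exact: mem_head.
  by rewrite cx cx'.
have [|f [fi _ _]] := partial_isometry_extend cY iI; last by exists f.
apply/dense_mdistP => x e e0; have [x' Dx' xx'] := (dense_mdistP _).1 dD x e e0.
by have [y Iy] := IT _ x' Dx' erefl; exists x' => //; exists (x', y).
Qed.

(** Each requirement treats one point of a dense set on either side, so the union has dense domain
    and dense range. The starting list [L] is a finite graph for homogeneity and empty for
    uniqueness. *)
Lemma back_and_forth (X Y : metricType R) (L : seq (X * Y)) :
  separable_metric X -> complete_metric X -> extension_property X ->
  separable_metric Y -> complete_metric Y -> extension_property Y ->
  partial_isometry [set` L] ->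
  exists f : X -> Y, [/\ isometric_map f, forall y, exists x, f x = y &
    forall p, p \in L -> f p.1 = p.2].
Proof.
move=> [D /countable_injP[c c_inj] dD] cX eX
  [E /countable_injP[k k_inj] dE] cY eY iL.
have [||n M iM|I [iI LI IT]] := @partial_isometry_chain X Y L
  (fun n I => (forall x, D x -> c x = n -> exists y, I (x, y)) /\
              (forall y, E y -> k y = n -> exists x, I (x, y))) .
- exact: iL.
- move=> n I J [nI nI'] IJ; split=> [x Dx cx|y Ey ky].
    by have [y Iy] := nI x Dx cx; exists y; exact: IJ.
  by have [x Ix] := nI' y Ey ky; exists x; exact: IJ.
- have [N iN [MN NT]] : exists2 N : seq (X * Y), partial_isometry [set` N] &
      [set` M] `<=` [set` N] /\
      forall x, D x -> c x = n -> exists y, (x, y) \in N.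
    have [[x Dx cx]|no] := pselect (exists2 x, D x & c x = n); last first.
      by exists M => //; split=> // x Dx cx; case: no; exists x.
    have [y yP] := partial_isometry_forth x eY iM.
    exists ((x, y) :: M) => //; split=> [p|x' Dx' cx'].
      by rewrite /= inE => ->; rewrite orbT.
    by exists y; rewrite (c_inj x' x) ?inE ?eqxx// cx cx'.
  have [[y Ey ky]|no] := pselect (exists2 y, E y & k y = n); last first.
    by exists N => //; split=> //; split=> // y Ey ky; case: no; exists y.
  have [x xP] := partial_isometry_back y eX iN.
  exists ((x, y) :: N) => //; split; [|split].
  + by move=> p /MN Np; rewrite /= inE Np orbT.
  + move=> x' Dx' cx'; have [y' Ny'] := NT x' Dx' cx'.
    by exists y'; rewrite /= inE Ny' orbT.
  + move=> y' Ey' ky'; exists x.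
    by rewrite /= (k_inj y' y) ?inE ?eqxx// ky ky'.
have dI : dense (fst @` I).
  apply/dense_mdistP => x e e0;
    have [x' Dx' xx'] := (dense_mdistP _).1 dD x e e0.
  by have [y Iy] := (IT _).1 x' Dx' erefl; exists x' => //; exists (x', y).
have dI2 : dense (snd @` I).
  apply/dense_mdistP => y e e0;
    have [y' Ey' yy'] := (dense_mdistP _).1 dE y e e0.
  by have [x Ix] := (IT _).2 y' Ey' erefl; exists y' => //; exists (x, y').
have [f [fi fI fs]] := partial_isometry_extend cY iI dI.
by exists f; split => // [|p pL]; [exact: fs|apply/fI/LI].
Qed.

Lemma urysohn_of_extension (X : metricType R) :
  separable_metric X -> complete_metric X -> extension_property X ->
  urysohn_space X.
Proof.
move=> sX cX eX; split=> //.
  by move=> M sM; exact: extension_property_universal.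
move=> A B f /finite_seqP[s ->] _ _ fi.
have [|g [gi gs gf]] := @back_and_forth X X [seq (x, f x) | x <- s]
    sX cX eX sX cX eX.
  by move=> _ _ /mapP[x xs ->] /mapP[y ys ->] /=; rewrite fi.
exists g; split=> // x xs; apply: (gf (x, f x)).
by apply/mapP; exists x.
Qed.

(* Extension problems over [U] are solved in [X] and brought back by the
   homogeneity of [U]. *)
Lemma urysohn_extension (X U : metricType R) :
  separable_metric X -> complete_metric X -> extension_property X ->
  urysohn_space U -> extension_property U.
Proof.
move=> sX cX eX [cU sU uU hU] T kT.
have [psi psi_i] := extension_property_universal sU cX eX.
have [phi phi_i] := uU X sX.
have [|x xT] := eX [seq (psi t.1, t.2) | t <- T].
  by move=> _ _ /mapP[t tT ->] /mapP[u uT ->] /=; rewrite psi_i; exact: kT.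
pose A := [set` map fst T]; pose f := phi \o psi.
have fi : isometric_map f by move=> u v; rewrite /f /= phi_i.
have [||||g [gi gs gA]] := hU A (f @` A) f.
- exact: finite_seq.
- by apply: finite_image; exact: finite_seq.
- split=> [u Au|u v _ _ fuv|_ [u Au <-]]; [by exists u| |by exists u].
  by apply: mdist_positivity; rewrite -fi fuv mdistxx.
- by move=> u v _ _; exact: fi.
(* [g] agrees with [f] on the points of [T], so a preimage of [phi x] under [g] has the prescribed
   distances to them. *)
have [u ux] := gs (phi x); exists u => t tT.
rewrite -gi ux gA; last by apply/mapP; exists t.
by rewrite phi_i (xT (psi t.1, t.2))//; apply/mapP; exists t.
Qed.

Lemma isometric_urysohn (X U : metricType R) :
  separable_metric X -> complete_metric X -> extension_property X ->
  urysohn_space U -> isometric X U.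
Proof.
move=> sX cX eX uU; have eU := urysohn_extension sX cX eX uU.
case: uU => cU sU _ _.
have [|f [fi fs _]] := @back_and_forth X U [::] sX cX eX sU cU eU;
  first by move=> p.
by exists f.
Qed.

End PartialIsometries.

(** * Adjoining a generator *)

Section OnePointNorm.
Variables (R : realType) (V : zmodType) (N : V -> R).
Hypotheses (N0 : N 0 = 0) (NN : forall a, N (- a) = N a)
  (ND : forall a b, N (a + b) <= N a + N b) (N_eq0 : forall a, N a = 0 ->
    a = 0).
Variable T : seq (V * R).
Hypotheses (T_neq0 : T != [::]) (T_gt0 : forall t : V * R, t \in T -> 0 < t.2)
  (TN : forall t u : V * R, t \in T -> u \in T -> N (t.1 - u.1) <= t.2 + u.2).

(* In V + Ze, the pair (P, Q) stands for the decomposition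
   a + m e = \sum_(p in P) (e - p) - \sum_(q in Q) (e - q) + y
   with y = a + \sum_P p - \sum_Q q and m = |P| - |Q|, where e - p and its
   opposite cost the weight of p, and y costs N y. *)
Definition relation_cost (P Q : seq (V * R)) (a : V) : R :=
  \sum_(t <- P) t.2 + \sum_(t <- Q) t.2
  + N (a + \sum_(t <- P) t.1 - \sum_(t <- Q) t.1).

Definition relation_words (m : int) (P Q : seq (V * R)) : Prop :=
  [/\ {subset P <= T}, {subset Q <= T} & (size P)%:Z - (size Q)%:Z = m].

Let N_ge0 a : 0 <= N a.
Proof. by have := ND a (- a); rewrite subrr N0 NN; lra. Qed.

Let sum_ge0 (P : seq (V * R)) : {subset P <= T} -> 0 <= \sum_(t <- P) t.2.
Proof.
by move=> PT; rewrite big_seq; apply: sumr_ge0 => t /PT/T_gt0/ltW.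
Qed.

Let sum_eq0 (P : seq (V * R)) : {subset P <= T} -> \sum_(t <- P) t.2 = 0 ->
  P = [::].
Proof.
case: P => // t P PT; rewrite big_cons.
have /T_gt0 := PT t (mem_head _ _).
have /sum_ge0 : {subset P <= T} by move=> u uP; apply: PT; rewrite inE uP orbT.
by move=> ? ? ?; exfalso; lra.
Qed.

(** Dropping [t] and [u] changes the argument of [N] by [t.1 - u.1], whose norm [TN] bounds by the
    saving [t.2 + u.2]. *)
Lemma relation_cost_cancel t u P Q a : t \in T -> u \in T ->
  relation_cost P Q a <= relation_cost (t :: P) (u :: Q) a.
Proof.
move=> tT uT; rewrite /relation_cost !big_cons.
set p := \sum_(t <- P) t.1; set q := \sum_(t <- Q) t.1.
have := ND (a + (t.1 + p) - (u.1 + q)) (- (t.1 - u.1)).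
rewrite NN (_ : _ - (t.1 - u.1) = a + p - q); last first.
  by rewrite (addrCA a) (opprD u.1) addrACA [LHS]addrC addKr.
have := TN tT uT; lra.
Qed.

Lemma relation_cost_reduce m P Q a : relation_words m P Q ->
  exists P' Q', [/\ relation_words m P' Q', P' = [::] \/ Q' = [::] &
    relation_cost P' Q' a <= relation_cost P Q a].
Proof.
elim: P Q => [|t P IH] Q w; first by exists [::], Q; split=> //; left.
case: Q w => [|u Q] w; first by exists (t :: P), [::]; split=> //; right.
case: w => PT QT PQm.
have [|P' [Q' [w' nil le]]] := IH Q.
  split=> [x xP|x xQ|]; [by apply: PT; rewrite inE xP orbT
    |by apply: QT; rewrite inE xQ orbT|by rewrite -PQm /=; lia].
exists P', Q'; split=> //; apply: le_trans le _.
by apply: relation_cost_cancel; [apply: PT|apply: QT]; rewrite mem_head.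
Qed.

Lemma seq_argmin (I : eqType) (s : seq I) (F : I -> R) : s != [::] ->
  exists2 t, t \in s & forall u, u \in s -> F t <= F u.
Proof.
elim: s => // t [_ _|t' s /(_ isT)[v vs vm] _].
  by exists t; rewrite ?mem_head// => u; rewrite inE => /eqP->.
have [tv|vt] := leP (F t) (F v).
  exists t; rewrite ?mem_head// => u; rewrite inE => /orP[/eqP->//|/vm].
  exact: le_trans.
exists v; first by rewrite inE vs orbT.
by move=> u; rewrite inE => /orP[/eqP->|/vm//]; exact: ltW.
Qed.

(** Minimize over the tail for each first letter, then over the letters of [T]; quantifying over [F]
    allows the induction to fix a letter. *)
Lemma word_argmin n (F : seq (V * R) -> R) :
  exists P : seq (V * R), [/\ {subset P <= T}, size P = n &
    forall P' : seq (V * R), {subset P' <= T} -> size P' = n -> F P <= F P'].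
Proof.
elim: n F => [|n IH] F.
  by exists [::]; split=> // P' _ /size0nil->.
have /choice[f fP] := fun t => IH (fun P => F (t :: P)).
have [t tT tm] := seq_argmin (fun t => F (t :: f t)) T_neq0.
have [fT fn fm] := fP t.
exists (t :: f t); split=> [x|/=|[//|u P'] PT' [sP']]; last 1 first.
- have uT := PT' u (mem_head _ _); apply: le_trans (tm u uT) _.
  by have [_ _] := fP u; apply=> // x xP; apply: PT'; rewrite inE xP orbT.
- by rewrite inE => /orP[/eqP->//|/fT].
- by rewrite fn.
Qed.

(** Once one side is cancelled, the other has length exactly [|m|], which leaves finitely many
    words. *)
Lemma relation_cost_argmin m a : exists PQ,
  [/\ relation_words m PQ.1 PQ.2, PQ.1 = [::] \/ PQ.2 = [::] &
    forall P Q, relation_words m P Q ->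
      relation_cost PQ.1 PQ.2 a <= relation_cost P Q a].
Proof.
have [m0|m0] := leP 0 m.
  have [P [PT Pm Pmin]] := word_argmin `|m|%N (fun P => relation_cost P [::] a).
  exists (P, [::]); split=> /=; [by split=> [|x|/=] //; lia|by right|].
  move=> P1 Q1 /(relation_cost_reduce a)[P' [Q' [[PT' QT' e] nil le]]].
  apply: le_trans le.
  have Q0 : Q' = [::] by case: nil => // P0; apply: size0nil; move: e;
    rewrite P0 /=; lia.
  by move: e; rewrite Q0 /= => e; apply: Pmin => //; lia.
have [P [PT Pm Pmin]] := word_argmin `|m|%N (fun P => relation_cost [::] P a).
exists ([::], P); split=> /=; [by split=> [x||/=] //; lia|by left|].
move=> P1 Q1 /(relation_cost_reduce a)[P' [Q' [[PT' QT' e] nil le]]].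
apply: le_trans le.
have P0 : P' = [::] by case: nil => // Q0; apply: size0nil; move: e;
  rewrite Q0 /=; lia.
by move: e; rewrite P0 /= => e; apply: Pmin => //; lia.
Qed.

Lemma one_point_norm : exists M : V -> int -> R,
  [/\ [/\ forall a, M a 0 = N a,
          forall a m, M (- a) (- m) = M a m,
          forall a b m n, M (a + b) (m + n) <= M a m + M b n &
          forall a m, M a m = 0 -> a = 0 /\ m = 0],
      forall a m, exists P Q, relation_words m P Q /\
        M a m = relation_cost P Q a,
      forall t, t \in T -> M (- t.1) 1 <= t.2 &
      forall t, t \in T -> exists2 u, u \in T &
        M (- t.1) 1 = u.2 + N (u.1 - t.1)].
Proof.
have /choice[w wP] := fun am : V * int => relation_cost_argmin am.2 am.1.
pose M a m := relation_cost (w (a, m)).1 (w (a, m)).2 a.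
have Mle a m P Q : relation_words m P Q -> M a m <= relation_cost P Q a.
  by have [_ _] := wP (a, m); apply.
have Msym a m : M (- a) (- m) <= M a m.
  rewrite /M; case: (w (a, m)) (wP (a, m)) => P Q [/= [PT QT e] _ _].
  have -> : relation_cost P Q a = relation_cost Q P (- a).
    rewrite /relation_cost [in RHS](addrC (\sum_(t <- Q) t.2)); congr (_ + _).
    by rewrite -NN !opprD opprK addrAC.
  by apply: Mle; split=> //; rewrite -e opprB.
exists M; split; first split.
(* For [m = 0] a reduced word is empty on both sides, so [M] extends [N]. *)
- move=> a; rewrite /M; case: (w _) (wP (a, 0)) => P Q [/= [_ _ e] nil _].
  have [-> ->] : P = [::] /\ Q = [::].
    by case: nil e => -> /= e; split=> //; apply: size0nil; lia.
  by rewrite /relation_cost !big_nil !add0r addr0 subr0.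
- move=> a m; apply/eqP; rewrite eq_le Msym /=.
  by have := Msym (- a) (- m); rewrite !opprK.
- move=> a b m n; rewrite {2 3}/M.
  case: (w (a, m)) (wP (a, m)) => P Q [/= [PT QT e] _ _].
  case: (w (b, n)) (wP (b, n)) => P' Q' [/= [PT' QT' e'] _ _].
  apply: le_trans (_ : relation_cost (P ++ P') (Q ++ Q') (a + b) <= _).
    apply: Mle; split=> [x|x|].
    + by rewrite mem_cat => /orP[/PT|/PT'].
    + by rewrite mem_cat => /orP[/QT|/QT'].
    + by rewrite !size_cat; lia.
  rewrite /relation_cost !big_cat /=.
  set p := \sum_(t <- P) t.1; set q := \sum_(t <- Q) t.1.
  set p' := \sum_(t <- P') t.1; set q' := \sum_(t <- Q') t.1.
  have := ND (a + p - q) (b + p' - q').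
  rewrite (_ : a + p - q + (b + p' - q') = a + b + (p + p') - (q + q')).
    by lra.
  by rewrite opprD (addrACA a b) (addrACA (a + p)).
- move=> a m; rewrite /M; case: (w _) (wP (a, m)) => P Q [/= [PT QT e] nil _].
  rewrite /relation_cost => c0.
  have := sum_ge0 PT; have := sum_ge0 QT;
    have := N_ge0 (a + \sum_(t <- P) t.1 - \sum_(t <- Q) t.1).
  move=> h1 h2 h3.
  have P0 : P = [::] by apply: sum_eq0 => //; lra.
  have Q0 : Q = [::] by apply: sum_eq0 => //; lra.
  move: c0 e; rewrite P0 Q0 !big_nil /= !add0r addr0 subr0 => /N_eq0-> <-.
  by [].
- by move=> a m; exists (w (a, m)).1, (w (a, m)).2; have [] := wP (a, m).
- move=> t tT; apply: le_trans (Mle _ _ [:: t] [::] _) _.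
    by split=> // x; rewrite inE => /eqP->.
  by rewrite /relation_cost !big_seq1 !big_nil addr0 subr0 addNr N0 addr0.
(* For [m = 1] the reduced word is a single relation [e - u]. *)
- move=> t tT; rewrite /M;
    case: (w _) (wP (- t.1, 1)) => P Q [/= [PT _ e] nil _].
  have Q0 : Q = [::].
    by case: nil e => // -> /= e; apply: size0nil; lia.
  move: e PT; rewrite Q0 /=; case: P {nil} => [|u [|? ?]] /= e PT; [lia| |lia].
  exists u; first exact/PT/mem_head.
  by rewrite /relation_cost !big_seq1 !big_nil subr0 addr0 [- t.1 + _]addrC.
Qed.

End OnePointNorm.

(** * Invariance of finitely generated metrics *)

Section FinitelyGeneratedFacts.
Variables (R : realType) (G : zmodType) (d : G -> G -> R).
Hypotheses (d_metric : is_metric d) (d_fg : finitely_generated_metric d).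

Lemma finitely_generated_subadditive a b a' b' :
  d (a + a') (b + b') <= d a b + d a' b'.
Proof.
have [A _ dA] := d_fg.
have [s [sA -> -> ->]] := (dA a b).1; have [s' [sA' -> -> ->]] := (dA a' b').1.
rewrite -!big_cat; apply: (dA _ _).2; exists (s ++ s'); split=> // p.
by rewrite mem_cat => /orP[/sA|/sA'].
Qed.

Lemma finitely_generated_invariant a b c : d (a + c) (b + c) = d a b.
Proof.
have [dxx _ _ _] := d_metric.
(* Adding the pair [(z, z)] costs nothing; translating back by [- c] gives the converse
   inequality. *)
have le x y z : d (x + z) (y + z) <= d x y.
  by have := finitely_generated_subadditive x y z z; rewrite dxx addr0.
apply/eqP; rewrite eq_le le /=.
by have := le (a + c) (b + c) (- c); rewrite !addrK.
Qed.

End FinitelyGeneratedFacts.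

Lemma calG_distD (R : realType) (K : calG R) (a b c : K) :
  calG_dist (a + c) (b + c) = calG_dist a b.
Proof. exact: finitely_generated_invariant (calG_metric K) (calG_fg K) a b c.
  Qed.

Lemma additive_map_of (U V : zmodType) (f : U -> V) :
  {morph f : x y / x - y} -> exists g : {additive U -> V}, g =1 f.
Proof.
move=> fB.
pose h := GRing.isZmodMorphism.Build U V f fB.
pose g : {additive U -> V} := HB.pack f h.
by exists g.
Qed.

(** * The one-generator extension inside the class *)

Section OnePointExtension.
Variables (R : realType) (K : calG R) (T : seq (K * R)).
Hypotheses (T_neq0 : T != [::])
  (T_gt0 : forall t : K * R, t \in T -> 0 < t.2)
  (T_rat : forall t : K * R, t \in T -> exists q : rat, t.2 = ratr q)
  (TK : forall t u : K * R, t \in T -> u \in T -> mdist t.1 u.1 <= t.2 + u.2).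

Let n := calG_rank K.
Let N (a : 'rV[int]_n) : R := @calG_dist R K a 0.

Lemma calG_distE (a b : K) : calG_dist a b = calG_dist (a - b) 0.
Proof. by rewrite -[LHS](calG_distD _ _ (- b)) subrr. Qed.

Lemma one_point_extension : exists (H : calG R) (rho : {additive K ->
  H}) (e : H),
  calM rho /\ forall t, t \in T -> mdist e (rho t.1) <= t.2 /\
    exists2 u, u \in T & u.2 + mdist u.1 t.1 <= mdist e (rho t.1).
Proof.
have NE (a b : K) : N (a - b) = calG_dist a b by rewrite /N -calG_distE.
have N0 : N 0 = 0 by exact: calG_distxx.
have NN a : N (- a) = N a.
  by rewrite -[- a]sub0r NE calG_dist_sym.
have ND a b : N (a + b) <= N a + N b.
  rewrite -[b]opprK NE NN; have := @calG_dist_triangle _ K 0 a (- b).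
  by rewrite (calG_dist_sym 0) -/(N _) -/(N _) NN.
have N_eq0 a : N a = 0 -> a = 0 by exact: calG_dist_eq0.
have TN (t u : K * R) : t \in T -> u \in T -> N (t.1 - u.1) <= t.2 + u.2.
  by move=> tT uT; rewrite NE; exact: TK.
have [M [[M0 MN MD M_eq0] Mcost Mle Mge]] :=
  one_point_norm N0 NN ND N_eq0 T_neq0 T_gt0 TN.
(* The first [n] coordinates are the part in [K], the last one is the coefficient of [e]. *)
pose dH (x y : 'rV[int]_(n + 1)) : R := M (lsubmx (x - y)) (rsubmx (x - y) 0 0).
have rsubE (x y : 'rV[int]_(n + 1)) :
    rsubmx (x - y) 0 0 = rsubmx x 0 0 - rsubmx y 0 0 by rewrite !mxE.
have rsubD (x y : 'rV[int]_(n + 1)) :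
    rsubmx (x + y) 0 0 = rsubmx x 0 0 + rsubmx y 0 0 by rewrite !mxE.
pose L (z : 'rV[int]_(n + 1)) := M (lsubmx z) (rsubmx z 0 0).
have LD z w : L (z + w) <= L z + L w by rewrite /L linearD rsubD; exact: MD.
have rsub_inj (x : 'rV[int]_(n + 1)) : rsubmx x 0 0 = 0 -> rsubmx x = 0.
  by move=> x0; apply/rowP => i; rewrite ord1 x0 mxE.
have dH_metric : is_metric dH.
  split.
  - by move=> x; rewrite /dH subrr linear0 !mxE M0.
  - move=> x y /M_eq0[l0 /rsub_inj r0]; apply/eqP; rewrite -subr_eq0.
    by rewrite -[x - y]hsubmxK l0 r0 row_mx0.
  - by move=> x y; rewrite /dH -[LHS]MN !rsubE opprB -linearN opprB.
  - move=> y x z; rewrite /dH -/(L (x - z)).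
    have -> : x - z = (x - y) + (y - z) by rewrite addrA subrK.
    exact: LD.
have [dHxx dH0 dHsym dHtri] := dH_metric.
have dHB (x y x' y' : 'rV[int]_(n + 1)) : dH (x + x') (y + y') <= dH x y +
  dH x' y'.
  rewrite /dH opprD addrACA -/(L _).
  exact: LD.
pose r (a : K) : 'rV[int]_(n + 1) := row_mx a 0.
pose e : 'rV[int]_(n + 1) := row_mx 0 1%:M.
have rB : {morph r : a b / a - b}.
  by move=> a b; rewrite /r opp_row_mx add_row_mx subrr.
have r_isom (a b : K) : dH (r a) (r b) = calG_dist a b.
  by rewrite /dH -rB /r row_mxKl row_mxKr mxE M0 NE.
have rD : {morph r : a b / a + b}.
  by move=> a b; rewrite /r add_row_mx addr0.
have r0 : r 0 = 0 by exact: row_mx0.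
have r_sum (I : Type) (s : seq I) (F : I -> K) :
    r (\sum_(i <- s) F i) = \sum_(i <- s) r (F i).
  by apply: big_morph.
have er (a : K) : dH e (r a) = M (- a) 1.
  by rewrite /dH /e /r opp_row_mx add_row_mx row_mxKl row_mxKr add0r oppr0
    addr0 mxE.
have er_le t : t \in T -> dH e (r t.1) <= t.2.
  by move=> tT; rewrite er; exact: Mle.
have dH_rat : rational_metric dH.
  have sum_rat P : {subset P <= T} ->
    exists q : rat, \sum_(t <- P) t.2 = ratr q.
    elim: P => [|t P IH] PT; first by exists 0; rewrite big_nil rmorph0.
    have [|q qP] := IH; first by move=> x xP; apply: PT; rewrite inE xP orbT.
    have [p tp] := T_rat (PT t (mem_head _ _)).
    by exists (p + q); rewrite big_cons tp qP rmorphD.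
  move=> x y; rewrite /dH;
    have [P [Q [[PT QT _] ->]]] := Mcost (lsubmx (x - y)) (rsubmx (x - y) 0 0).
  have [p pP] := sum_rat P PT; have [q qQ] := sum_rat Q QT.
  rewrite /relation_cost pP qQ /N.
  have [s ->] := @calG_rational R K
    (lsubmx (x - y) + \sum_(t <- P) t.1 - \sum_(t <- Q) t.1) 0.
  by exists (p + q + s); rewrite !rmorphD.
have dH_fg : finitely_generated_metric dH.
  have [A fA dA] := calG_fg K.
  (* The pairs of [e] with [r t.1], in both orders, realize the relations; [(e, e)] and [(- e, - e)]
     supply common multiples of [e] at cost 0. *)
  pose gens := [:: (e, e); (- e, - e)] ++ [seq (e, r t.1) | t <- T]
               ++ [seq (r t.1, e) | t <- T].
  pose S := [set` gens] `|` [set (r p.1, r p.2) | p in A].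
  exists S; first by rewrite finite_setU; split;
    [exact: finite_seq|exact: finite_image].
  move=> x y.
  have lb : lbound (decomposition_costs dH S x y) (dH x y).
    move=> _ [s [_ -> -> ->]]; elim: s => [|p s IH];
      first by rewrite !big_nil dHxx.
    by rewrite !big_cons; apply: le_trans (dHB _ _ _ _) _; rewrite lerD2l.
  split=> //.
  (* An upper bound on the cost suffices, as [lb] gives the reverse inequality. *)
  pose dec (x y : 'rV[int]_(n + 1)) c :=
    exists s : seq ('rV[int]_(n + 1) * 'rV[int]_(n + 1)),
    [/\ forall p, p \in s -> S p, x = \sum_(p <- s) p.1, y = \sum_(p <- s) p.2 &
        \sum_(p <- s) dH p.1 p.2 <= c].
  have dec0 : dec 0 0 0 by exists [::]; rewrite !big_nil.
  have decD x1 y1 c1 x2 y2 c2 : dec x1 y1 c1 -> dec x2 y2 c2 ->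
      dec (x1 + x2) (y1 + y2) (c1 + c2).
    move=> [s1 [S1 -> -> le1]] [s2 [S2 -> -> le2]]; exists (s1 ++ s2).
    rewrite !big_cat; split=> //; last exact: lerD.
    by move=> p; rewrite mem_cat => /orP[/S1|/S2].
  have dec1 (p : 'rV[int]_(n + 1) * 'rV[int]_(n + 1)) c :
      p \in gens -> dH p.1 p.2 <= c -> dec p.1 p.2 c.
    move=> pS pc; exists [:: p]; rewrite !big_seq1; split=> // q.
    by rewrite inE => /eqP->; left.
  have decK (a b : K) : dec (r a) (r b) (calG_dist a b).
    have [s [sA -> -> ->]] := (dA a b).1.
    exists [seq (r p.1, r p.2) | p <- s]; rewrite !big_map; split.
    - by move=> _ /mapP[p /sA Ap ->]; right; exists p.
    - exact: r_sum.
    - exact: r_sum.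
    - by rewrite ler_sum// => p _; rewrite r_isom.
  have dece c : dec (e *~ c) (e *~ c) 0.
    have dec_nat x1 m : (x1, x1) \in gens -> dec (x1 *+ m) (x1 *+ m) 0.
      move=> x1S; elim: m => [|m IH]; first by rewrite mulr0n.
      rewrite mulrS -[0]addr0; apply: decD => //.
      by apply: (dec1 (x1, x1)) => //=; rewrite dHxx.
    case: c => m; first by rewrite -pmulrn; apply: dec_nat; rewrite inE eqxx.
    by rewrite NegzE mulrNz -mulNrz -pmulrn; apply: dec_nat;
      rewrite !inE eqxx orbT.
  have decP P : {subset P <= T} ->
      dec (e *+ size P) (r (\sum_(t <- P) t.1)) (\sum_(t <- P) t.2) /\
      dec (r (\sum_(t <- P) t.1)) (e *+ size P) (\sum_(t <- P) t.2).
    elim: P => [|t P IH] PT; first by rewrite !big_nil r0.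
    have [|IH1 IH2] := IH; first by move=> u uP; apply: PT; rewrite inE uP orbT.
    have tT := PT t (mem_head _ _).
    rewrite !big_cons mulrS rD; split; apply: decD => //.
      apply: (dec1 (e, r t.1)); last exact: er_le.
      by rewrite !mem_cat; apply/or3P/Or32/mapP; exists t.
    apply: (dec1 (r t.1, e)); last by rewrite dHsym; exact: er_le.
    by rewrite !mem_cat; apply/or3P/Or33/mapP; exists t.
  have [P [Q [[PT QT PQ] cE]]] := Mcost (lsubmx (x - y)) (rsubmx (x - y) 0 0).
  rewrite rsubE in PQ.
  (* The relations in [P] are used as [(e, p)] and those in [Q] as [(q, e)]; [(a, b)] is the
     remainder in [K]. By [PQ] the leftover multiple [c] of [e] is the same for [x] and [y]. *)
  pose a : K := lsubmx x - \sum_(t <- Q) t.1.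
  pose b : K := lsubmx y - \sum_(t <- P) t.1.
  pose c := rsubmx x 0 0 - (size P)%:Z.
  have xyE (z : 'rV[int]_(n + 1)) : z = r (lsubmx z) + e *~ rsubmx z 0 0.
    rewrite -scaler_int intz /r /e scale_row_mx scaler0 add_row_mx addr0 add0r.
    rewrite -[LHS]hsubmxK; congr row_mx; apply/rowP => j.
    by rewrite ord1 !mxE mulr1.
  have [s [sS xs ys le]] : dec x y (dH x y).
    have -> : dH x y = \sum_(t <- P) t.2 + (\sum_(t <- Q) t.2 + (0 +
      calG_dist a b)).
      rewrite add0r addrA calG_distE [LHS]cE; congr (_ + N _).
      rewrite /a /b linearB opprB -!addrA; congr (_ + _).
      by rewrite [LHS]addrC addrAC [LHS]addrC.
    have split4 (x1 x2 y1 y2 : 'rV[int]_(n + 1)) :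
        x1 + x2 = y1 + (y2 + ((x2 - y1) + (x1 - y2))).
      by rewrite addrACA -opprD addrA [RHS]addrC subrK addrC.
    have -> : x = e *+ size P + (r (\sum_(t <- Q) t.1) + (e *~ c + r a)).
      by rewrite {1}(xyE x) /c /a rB mulrzBr -pmulrn -split4.
    have -> : y = r (\sum_(t <- P) t.1) + (e *+ size Q + (e *~ c + r b)).
      rewrite {1}(xyE y) (_ : c = rsubmx y 0 0 - (size Q)%:Z); last first.
        by rewrite /c; move: (rsubmx x 0 0) (rsubmx y 0 0) PQ => u v; lia.
      by rewrite /b rB mulrzBr -pmulrn addrCA -split4.
    by apply: decD (decP P PT).1 (decD _ _ _ _ _ _ (decP Q QT).2 (decD _ _ _ _
      _ _ (dece c) (decK a b))).
  exists s; split=> //; apply/eqP; rewrite eq_le le andbT.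
  by apply: lb; exists s.
pose H := CalG dH_metric dH_fg dH_rat.
have [rho rhoE] := @additive_map_of K H r rB.
exists H, rho, (e : H); split; first split.
- move=> a b; rewrite !rhoE => /(congr1 (@lsubmx _ 1 n 1)).
  by rewrite !row_mxKl.
- by move=> a b; rewrite !rhoE; exact: r_isom.
- move=> i; exists (lshift 1 i); rewrite rhoE /calG_gen.
  by rewrite delta_mx_lshift.
- move=> t tT; rewrite rhoE; split; first exact: er_le.
  have [u uT ue] := Mge t tT; exists u => //.
  by rewrite [X in _ <= X](er t.1) ue NE.
Qed.

End OnePointExtension.

(** * The Fraisse limit *)

Section FraisseLimit.
Variable R : realType.

Lemma direct_limit_seq (G : zmodType) (K : nat -> calG R)
    (c : forall n, {additive K n -> K n.+1}) (g : forall n, {additive K n ->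
      G}) :
  (forall n (x : K n), g n.+1 (c n x) = g n x) ->
  (forall x : G, exists n (y : K n), g n y = x) ->
  forall T : seq (G * R), exists n (S : seq (K n * R)),
    T = [seq (g n t.1, t.2) | t <- S].
Proof.
move=> gc gsurj.
have lift n m : (n <= m)%N -> forall y : K n, exists z : K m, g m z = g n y.
  elim: m => [|m IH].
    by rewrite leqn0 => /eqP-> y; exists y.
  rewrite leq_eqVlt => /orP[/eqP<- y|nm y]; first by exists y.
  by have [z <-] := IH nm y; exists (c m z).
elim=> [|[x v] T [n [S ->]]]; first by exists 0%N, [::].
have [m [y <-]] := gsurj x.
have [z zE] := lift _ _ (leq_maxr n m) y.
have /choice[f fE] := lift _ _ (leq_maxl n m).
exists (maxn n m), ((z, v) :: [seq (f t.1, t.2) | t <- S]).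
by rewrite /= zE -map_comp; congr (_ :: _); apply: eq_map => t /=; rewrite fE.
Qed.

(** With the triangle inequality the conclusion says that the distance from [x] to [p] is the
    minimum over [q] of [f q + d(q, p)]. *)
Lemma fraisse_limit_extension (G : metricZmodType R) (T : seq (G * R)) :
  fraisse_limit G -> T != [::] ->
  (forall t, t \in T -> 0 < t.2) ->
  (forall t, t \in T -> exists q : rat, t.2 = ratr q) ->
  (forall t u, t \in T -> u \in T -> mdist t.1 u.1 <= t.2 + u.2) ->
  exists x, forall t, t \in T -> mdist x t.1 <= t.2 /\
    exists2 u, u \in T & u.2 + mdist u.1 t.1 <= mdist x t.1.
Proof.
move=> [_ _ [K [c [g [[cM gi gc gsurj] _ amalg]]]]].
have [n [S ->]] := direct_limit_seq gc gsurj T => S_neq0 T_gt0 T_rat TK.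
have inT (t : K n * R) : t \in S ->
  (g n t.1, t.2) \in [seq (g n t.1, t.2) | t <- S].
  by move=> tS; apply/mapP; exists t.
have [||||H [rho [e [rhoM eP]]]] := @one_point_extension R (K n) S.
- by case: (S) S_neq0.
- by move=> t /inT/T_gt0.
- by move=> t /inT/T_rat.
- by move=> t u /inT tT /inT uT; rewrite -(gi n); exact: (TK _ _ tT uT).
(* Amalgamating along the identity of [K n] puts the new generator in a later [K m] while fixing the
   points of [K n] in [G]. *)
have idM : calM (idfun : {additive K n -> K n}).
  by split=> // i; exists i.
have [m [i2 [_ [_ i2i _] i2E]]] := amalg _ _ n _ rho idM rhoM.
have dE (z : K n) : mdist (g m (i2 e)) (g n z) = mdist e (rho z).
  by rewrite -[g n z]/(g n (idfun z)) -i2E gi i2i.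
exists (g m (i2 e)) => _ /mapP[t tS ->] /=; rewrite dE.
have [le [u uS ue]] := eP t tS; split=> //.
by exists (g n u.1, u.2); [exact: inT|rewrite /= gi].
Qed.

Lemma completion_approximate_extension (G GG : metricZmodType R)
    (i : {additive G -> GG}) :
  fraisse_limit G -> metric_group_completion i ->
  approximate_extension_property GG.
Proof.
move=> fG [_ _ ii /dense_mdistP di] T e e0 kT.
have [->|T_neq0] := eqVneq T [::]; first by exists 0.
have e30 : 0 < e / 3 by rewrite divr_gt0.
(* Points move by less than [e / 3], so distances change by at most 2e/3; raising each value by at
   least [e / 3] compensates for this and makes the values positive. *)
have /choice[F FP] : forall t : GG * R, exists s : G * R,
    [/\ mdist t.1 (i s.1) < e / 3, exists q : rat, s.2 = ratr q &
        t.2 + e / 3 < s.2 < t.2 + e / 3 + e / 3].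
  move=> t; have [_ [x _ <-] tx] := di t.1 _ e30.
  have [|q] := @rat_in_itvoo R (t.2 + e / 3) (t.2 + e / 3 + e / 3).
    by rewrite ltrDl.
  by rewrite in_itv /= => tq; exists (x, ratr q); split=> //; exists q.
have dF (t u : GG * R) : mdist (F t).1 (F u).1 <= mdist t.1 u.1 + e / 3 +
  e / 3 /\
    mdist t.1 u.1 <= mdist (F t).1 (F u).1 + e / 3 + e / 3.
  rewrite -ii; have [td _ _] := FP t; have [ud _ _] := FP u.
  have := metric_triangle (i (F t).1) t.1 (i (F u).1).
  have := metric_triangle t.1 u.1 (i (F u).1).
  have := metric_triangle t.1 (i (F t).1) u.1.
  have := metric_triangle (i (F t).1) (i (F u).1) u.1.
  rewrite (metric_sym (i (F t).1) t.1) (metric_sym (i (F u).1) u.1).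
  by move=> *; split; lra.
have [|||| x xP] := @fraisse_limit_extension G [seq F t | t <- T] fG.
- by case: (T) T_neq0.
- move=> _ /mapP[t tT ->]; have [_ _ /andP[+ _]] := FP t.
  have := katetov_ge0 kT tT; lra.
- by move=> _ /mapP[t tT ->]; have [] := FP t.
- move=> _ _ /mapP[t tT ->] /mapP[u uT ->].
  have [_ _ /andP[t1 _]] := FP t; have [_ _ /andP[u1 _]] := FP u.
  have [_ tu] := kT t u tT uT; have [d1 _] := dF t u; lra.
exists (i x) => t tT.
have [le [_ /mapP[u uT ->] ge]] := xP _ (map_f F tT).
have [td _ /andP[t1 t2]] := FP t; have [ud _ /andP[u1 u2]] := FP u.
(* The lower bound comes from the minimizing [u], through [t.2 <= mdist t.1 u.1 + u.2]. *)
have [_ d2] := dF u t; have [tu _] := kT t u tT uT.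
rewrite (metric_sym t.1) in tu.
have := metric_triangle (i x) t.1 (i (F t).1).
have := metric_triangle (i x) (i (F t).1) t.1.
by rewrite (metric_sym (i (F t).1) t.1) ii => *; apply/ler_normlP; split; lra.
Qed.

End FraisseLimit.

Theorem proposition2p6 (R : realType) (G GG : metricZmodType R)
    (i : {additive G -> GG}) :
  fraisse_limit G ->
  metric_group_completion i ->
  (exists U : metricType R, urysohn_space U) /\
  (forall U : metricType R, urysohn_space U -> isometric GG U).
Proof.
move=> fG cGG; have [cG _ _] := fG; have [cplGG _ _ di] := cGG.
have sGG : separable_metric GG.
  by exists (range i) => //; exact: sub_countable (card_image_le _ _) cG.
have eGG := complete_extension cplGG (completion_approximate_extension fG cGG).
split; first by exists GG; exact: urysohn_of_extension.
by move=> U; exact: isometric_urysohn.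
Qed.
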